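(* Four firefighters are necessary and sufficient to contain a fire on the infinite strong grid $G_{\boxtimes}$ in the distance-$2$ firefighter game; that is, $f_2(G_{\boxtimes}) = 4$.
   Context: $G_{\boxtimes}$ is the infinite strong grid: vertex set $\mathbb{Z}\times\mathbb{Z}$, with two distinct vertices adjacent if and only if each of their coordinates differs by at most $1$. Distance-$d$ (distance-restricted) firefighter game on a graph $G$ with $k$ firefighters and fire at $u$: on turn $0$, the vertex $u$ starts burning, and then the $k$ firefighters are placed on unburnt vertices (several may occupy the same vertex), protecting the vertices they occupy. On each turn $t+1$ ($t\ge 0$), first the fire spreads to every unburnt, unprotected neighbour of every burning vertex; then each firefighter moves from its current vertex to an unburnt vertex at distance at most $d$ (possibly staying put, and several may occupy the same vertex), where the distance is measured in the subgraph of $G$ induced by the currently unburnt vertices (firefighters may not move through the fire), and protects the vertex it arrives at. Once a vertex is burning or protected it remains so for the rest of the game. The fire is contained if after finitely many turns a point is reached where the fire can no longer spread (no burning vertex has an unburnt, unprotected neighbour). $f_d(G,u)$ is the minimum $k$ for which a fire breaking out at $u$ can be contained; for a vertex-transitive graph $G$ this does not depend on $u$ and is written $f_d(G)$. *)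

(* Defs.v *)
From mathcomp Require Import all_boot all_order all_algebra.
From mathcomp Require Import classical_sets.
Set Implicit Arguments.
Unset Strict Implicit.
Unset Printing Implicit Defensive.
Import Order.TTheory GRing.Theory Num.Theory.
Local Open Scope classical_set_scope.

Record sgraph := SGraph {
  vertex :> Type;
  adj : rel vertex;
  adj_sym : symmetric adj;
  adj_irrefl : irreflexive adj }.

Arguments adj {s}.

(* The vertices that burn next, when [B] is burning and [P] is protected. *)
Definition threatened (G : sgraph) (B P : set G) : set G :=
  [set v | [/\ ~ B v, ~ P v & exists2 w, B w & adj w v]].

(* [x] and [y] are at distance at most [d] in the subgraph of [G] induced by
   [A]: some walk inside [A] with at most [d] edges joins them. *)
Definition dist_le_in (G : sgraph) (A : set G) (d : nat) (x y : G) : Prop :=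
  exists p : seq G, [/\ path adj x p, last x p = y, (size p <= d)%N
    & forall i, (i <= size p)%N -> A (nth x (x :: p) i)].

(* The fire is deterministic, so a play with [k] firefighters is determined by
   their positions: [pos t i] is the vertex occupied by firefighter [i] at the
   end of turn [t]. *)
Definition positions (G : sgraph) (k : nat) : Type := nat -> 'I_k -> G.

Definition protected (G : sgraph) (k : nat) (pos : positions G k) (t : nat) :
    set G :=
  [set v | exists s (i : 'I_k), (s <= t)%N /\ pos s i = v].

Fixpoint burning (G : sgraph) (k : nat) (u : G) (pos : positions G k)
    (t : nat) : set G :=
  if t is s.+1 then
    burning u pos s `|` threatened (burning u pos s) (protected pos s)
  else [set u].

(* Firefighters move after the fire has spread on the same turn, hence the
   index [t.+1] of the burning set. Legality is required at all turns: this
   loses nothing, as staying put is always legal. *)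
Definition legal (G : sgraph) (d k : nat) (u : G) (pos : positions G k) :
    Prop :=
  (forall i, ~ burning u pos 0 (pos 0%N i)) /\
  (forall t i, dist_le_in (~` burning u pos t.+1) d (pos t i) (pos t.+1 i)).

Definition contained (G : sgraph) (k : nat) (u : G) (pos : positions G k) :
    Prop :=
  exists t, threatened (burning u pos t) (protected pos t) = set0.

Definition containable (G : sgraph) (d : nat) (u : G) (k : nat) : Prop :=
  exists pos : positions G k, legal d u pos /\ contained u pos.

(* f_d(G, u) = k; stated as a relation because a fire need not be containable
   by any finite number of firefighters. *)
Definition fire_number_at (G : sgraph) (d : nat) (u : G) (k : nat) : Prop :=
  containable d u k /\ forall j, containable d u j -> (k <= j)%N.

(* f_d(G) = k, for a graph [G] in which f_d(G, u) does not depend on u. *)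
Definition fire_number (G : sgraph) (d k : nat) : Prop :=
  forall u : G, fire_number_at d u k.

Definition strong_adj : rel (int * int) := fun x y =>
  [&& x != y, `|x.1 - y.1| <= 1 & `|x.2 - y.2| <= 1]%R.

Lemma strong_adj_sym : symmetric strong_adj.
Proof.
by move=> x y; rewrite /strong_adj eq_sym (distrC x.1) (distrC x.2).
Qed.

Lemma strong_adj_irrefl : irreflexive strong_adj.
Proof. by move=> x; rewrite /strong_adj eqxx. Qed.

Definition strong_grid : sgraph := SGraph strong_adj_sym strong_adj_irrefl.

(* Main.v *)
Require Import Defs.
From mathcomp Require Import all_boot all_order all_algebra.
From mathcomp Require Import boolp classical_sets.
From mathcomp Require Import zify.

(** Lower bound. Let the fire have a bounding box of size [W] x [H] after turn
    [t]. A side of the box is held on a turn if the fire does not cross it. If at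
    most one side is held on each of the first [t] turns, then [W + H >= 3t + 2].
    Holding two sides on the next turn would require more than [3(t + 1)]
    protected cells next to the fire: every unburnt cell of a side of the box is
    paid for by a protected cell, and holding a side takes two more protected
    cells outside than the side has burning cells, so that two adjacent held
    sides cost [W + H + 3] in all. For two opposite sides, say north and south,
    the same count only gives [2W + 4]; counting along these two sides alone
    gives [2W + 4 + 2(H - W)], as each turn on which the east or west side is
    held costs two cells that the box never contains, and the average of the two
    bounds is [W + H + 4]. So with three firefighters the box grows forever.

    Upper bound. Four firefighters wall in a 33 x 13 box in 32 turns. *)

Set Implicit Arguments.
Unset Strict Implicit.
Unset Printing Implicit Defensive.
Import Order.TTheory GRing.Theory Num.Theory.
Local Open Scope ring_scope.

(** * Counting on integer intervals *)

Definition zrange (lo hi : int) : seq int :=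
  [seq lo + i%:Z | i <- iota 0 (absz (Num.max 0 (hi - lo + 1)))].

Lemma mem_zrange lo hi x : (x \in zrange lo hi) = (lo <= x <= hi).
Proof.
apply/mapP/idP => [[i]|H]; first by rewrite mem_iota => + ->; lia.
by exists (absz (x - lo)); [rewrite mem_iota|]; lia.
Qed.

Lemma zrange_uniq lo hi : uniq (zrange lo hi).
Proof. by rewrite map_inj_uniq ?iota_uniq // => i j; lia. Qed.

Lemma size_zrange lo hi : lo <= hi + 1 ->
  (size (zrange lo hi))%:Z = hi - lo + 1.
Proof. by rewrite size_map size_iota; lia. Qed.

Lemma zrange_cat k lo hi : lo - 1 <= k <= hi ->
  zrange lo hi = zrange lo k ++ zrange (k + 1) hi.
Proof.
move=> Hk; rewrite /zrange.
have -> : absz (Num.max 0 (hi - lo + 1)) =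
    (absz (Num.max 0%R (k - lo + 1)%R) + absz (Num.max 0%R (hi - (k + 1) + 1)%R))%N by lia.
rewrite iotaD map_cat add0n; congr (_ ++ _).
rewrite -[X in iota X _]addn0 iotaDl -map_comp; apply: eq_map => i /=; lia.
Qed.

Lemma zrange1 x : zrange x x = [:: x].
Proof.
rewrite /zrange (_ : absz _ = 1%N); last by lia.
by rewrite /= addr0.
Qed.

Lemma zrange_shift c lo hi :
  zrange (lo + c) (hi + c) = [seq x + c | x <- zrange lo hi].
Proof.
rewrite /zrange -map_comp.
rewrite (_ : hi + c - (lo + c) + 1 = hi - lo + 1); last by lia.
by apply: eq_map => i /=; lia.
Qed.

Lemma sub_in_count (T : eqType) (a1 a2 : pred T) (s : seq T) :
  {in s, forall x, a1 x -> a2 x} -> (count a1 s <= count a2 s)%N.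
Proof.
move=> sub; rewrite (@eq_in_count _ a1 [pred x | (x \in s) && a1 x]).
  rewrite (@eq_in_count _ a2 [pred x | (x \in s) && a2 x]); last by move=> x /= ->.
  by apply: sub_count => x /= /andP[xs a1x]; rewrite xs sub.
by move=> x /= ->.
Qed.

Lemma leq_count_zrange (q r : pred int) (c lo hi lo' hi' : int) :
    lo' = lo + c -> hi' = hi + c ->
    (forall x, lo <= x <= hi -> q x -> r (x + c)) ->
  (count q (zrange lo hi) <= count r (zrange lo' hi'))%N.
Proof.
move=> -> -> qr; rewrite zrange_shift [leqRHS]count_map.
by apply: sub_in_count => x; rewrite mem_zrange => /qr.
Qed.

(* On either side of a point [z] of [p], moving one step towards [z] maps the
   points of [q] injectively to points outside [p]. *)
Lemma count_spread (p q : pred int) (lo hi z : int) : lo <= z <= hi -> p z ->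
    (forall x y, p x -> `|y - x| <= 1 -> ~~ q y) ->
  (count q (zrange (lo - 1) (hi + 1)) <= count (predC p) (zrange lo hi))%N.
Proof.
move=> Hz pz pq.
have qz : q z = false by apply/negbTE/(pq z) => //; lia.
have pNq x y : `|y - x| <= 1 -> q y -> predC p x.
  by move=> xy qy; apply/negP => px; move: (pq _ _ px xy); rewrite qy.
rewrite (@zrange_cat z (lo - 1)); last by lia.
rewrite (@zrange_cat (z - 1) (lo - 1) z); last by lia.
rewrite (@zrange_cat (z - 1) lo hi); last by lia.
rewrite subrK zrange1 !count_cat /= qz !addn0; apply: leq_add.
  have -> : count (predC p) (zrange lo (z - 1)) = count (predC p) (zrange lo z).
    rewrite (@zrange_cat (z - 1) lo z); last by lia.
    by rewrite subrK zrange1 count_cat /= pz /= !addn0.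
  by apply: (leq_count_zrange (c := 1)) => [||x _]; try lia; apply: pNq; lia.
by apply: (leq_count_zrange (c := -1)) => [||x _]; try lia; apply: pNq; lia.
Qed.

(** * One turn of the fire, seen from one side of the box *)

Notation cell := (int * int)%type.

Definition near (v w : cell) : bool :=
  (`|v.1 - w.1| <= 1) && (`|v.2 - w.2| <= 1).

(* [b] burns before and [b'] after a turn; [d] lists the cells saved from
   [b] on that turn. *)
Record fire_step (b b' : pred cell) (d : seq cell) : Prop := FireStep {
  step_mono : forall v, b v -> b' v;
  step_near : forall v, b' v -> exists2 w, b w & near w v;
  step_spread : forall w v, b w -> near w v -> b' v || (v \in d);
  saved_unburnt : forall v, v \in d -> ~~ b' v;
  saved_near : forall v, v \in d -> exists2 w, b w & near w v;
  saved_uniq : uniq d }.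

(* Coordinates in which a given side of the bounding box is the top one. *)
Record frame := Frame {
  along : cell -> int;
  height : cell -> int;
  mk : int -> int -> cell;
  mk_along : forall x h, along (mk x h) = x;
  mk_height : forall x h, height (mk x h) = h;
  mkK : forall v, mk (along v) (height v) = v;
  near_frame : forall v w, near v w =
    (`|along v - along w| <= 1) && (`|height v - height w| <= 1) }.

(** Only the top side is required to touch the fire; the four frames together make the box a
    bounding box. *)
Record hull (f : frame) (b : pred cell) (lo hi h : int) : Prop := Hull {
  hull_in : forall v, b v ->
    [&& lo <= along f v, along f v <= hi & height f v <= h];
  hull_top : exists2 x, lo <= x <= hi & b (mk f x h) }.

Definition gap (f : frame) (b : pred cell) (lo hi h : int) : nat :=
  count (fun x => ~~ b (mk f x h)) (zrange lo hi).

Definition hits (f : frame) (d : seq cell) (h : int) : nat :=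
  count (fun v => height f v == h + 1) d.

Lemma count_mk_hits f d h lo hi : uniq d ->
  (count (fun x => mk f x (h + 1) \in d) (zrange lo hi) <= hits f d h)%N.
Proof.
move=> d_uniq; rewrite /hits -!size_filter.
rewrite -(size_map (fun x => mk f x (h + 1)) (filter _ _)).
apply: uniq_leq_size.
  rewrite map_inj_uniq ?filter_uniq ?zrange_uniq // => x y /(congr1 (along f)).
  by rewrite !mk_along.
move=> v /mapP[x]; rewrite mem_filter => /andP[xd _] ->.
by rewrite mem_filter mk_height eqxx.
Qed.

(** An unburnt cell of the row above the side is either saved, hence counted in [hits], or has no
    burning neighbour on the side; [count_spread] bounds the number of the latter by the gap. *)
Lemma count_front f b b' d lo hi h : fire_step b b' d -> hull f b lo hi h ->
  (count (fun x => ~~ b' (mk f x (h + 1))) (zrange (lo - 1) (hi + 1)) <=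
   gap f b lo hi h + hits f d h)%N.
Proof.
move=> st [_ [z z_in bz]].
pose saved x := mk f x (h + 1) \in d.
pose safe x := ~~ b' (mk f x (h + 1)) && ~~ saved x.
have le_safe : (count safe (zrange (lo - 1) (hi + 1)) <= gap f b lo hi h)%N.
  apply: (@count_spread (fun x => b (mk f x h)) _ lo hi z) => // x y bx xy.
  have := step_spread st (v := mk f y (h + 1)) bx.
  rewrite /safe /saved (near_frame f) !mk_along !mk_height.
  case: (b' _); case: (_ \in d) => //=; lia.
have := count_mk_hits f h (lo - 1) (hi + 1) (saved_uniq st).
move=> /(leq_add le_safe)/(leq_trans _); apply.
rewrite -count_predUI; apply: leq_trans (leq_addr _ _).
by apply: sub_count => x /=; rewrite /safe /saved; case: (b' _); case: (_ \in d).
Qed.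

Lemma hull_le f b lo hi h : hull f b lo hi h -> lo <= hi.
Proof. by case=> _ [x] Hx _; lia. Qed.

Lemma held_cost f b b' d lo hi h : fire_step b b' d -> hull f b lo hi h ->
    (forall v, b' v -> height f v <= h) ->
  hi - lo + 3 <= (gap f b lo hi h + hits f d h)%:Z.
Proof.
move=> st hl held; have lohi := hull_le hl.
have := count_front st hl; rewrite (@eq_count _ _ predT) ?count_predT.
  have := @size_zrange (lo - 1) (hi + 1); lia.
move=> x; apply/negP => /held; rewrite mk_height; lia.
Qed.

(** The row of [count_front] sticks out by one cell at each end. Where the neighbouring side is
    held, this end cell is unburnt but outside the new box, so it is missing from the new gap. *)
Lemma gap_advance f b b' d lo hi h (aL aR : bool) :
    fire_step b b' d -> hull f b lo hi h ->
    (forall v, b' v -> lo - aL%:Z <= along f v <= hi + aR%:Z) ->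
  (gap f b' (lo - aL%:Z) (hi + aR%:Z) (h + 1) + ~~ aL + ~~ aR <=
   gap f b lo hi h + hits f d h)%N.
Proof.
move=> st hl b'_in; have lohi := hull_le hl.
apply: leq_trans (count_front st hl).
rewrite (@zrange_cat (lo - aL%:Z - 1) (lo - 1)); last by lia.
rewrite subrK (@zrange_cat (hi + aR%:Z) _ (hi + 1)); last by lia.
rewrite !count_cat /gap.
have out x : ~~ (lo - aL%:Z <= x <= hi + aR%:Z) -> ~~ b' (mk f x (h + 1)).
  by apply: contra => /b'_in; rewrite mk_along.
have outs x y : (forall z, x <= z <= y -> ~~ (lo - aL%:Z <= z <= hi + aR%:Z)) ->
    count (fun z => ~~ b' (mk f z (h + 1))) (zrange x y) = size (zrange x y).
  move=> xy; apply/eqP; rewrite -all_count; apply/allP => z.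
  by rewrite mem_zrange => /xy/out.
rewrite (outs (lo - 1)) 1?(outs (hi + aR%:Z + 1)); try by move=> z; lia.
have := @size_zrange (lo - 1) (lo - aL%:Z - 1).
have := @size_zrange (hi + aR%:Z + 1) (hi + 1).
lia.
Qed.

Lemma gap_ends f b lo hi h : hull f b lo hi h ->
  gap f b lo hi h = if lo == hi then 0%N else
    (~~ b (mk f lo h) + count (fun x => ~~ b (mk f x h))
      (zrange (lo + 1) (hi - 1)) + ~~ b (mk f hi h))%N.
Proof.
move=> hl; have lohi := hull_le hl; rewrite /gap.
case: eqP => [lo_hi|lo_hi].
  rewrite -lo_hi zrange1 /= addn0; case: hl => _ [x] Hx.
  by have -> : x = lo by [lia]; move=> ->.
rewrite (@zrange_cat lo lo hi); last by lia.
rewrite (@zrange_cat (hi - 1) (lo + 1) hi); last by lia.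
by rewrite subrK !zrange1 !count_cat /= !addn0 addnA.
Qed.

Lemma gap_corners f b lo hi h : hull f b lo hi h ->
  (~~ b (mk f lo h) + ~~ b (mk f hi h) <= gap f b lo hi h)%N.
Proof.
move=> hl; rewrite (gap_ends hl); case: eqP => [lo_hi|_]; last by lia.
case: hl => _ [x] Hx; have -> : x = lo by lia.
by rewrite -lo_hi => ->.
Qed.

(** Burning cells stay burning, so only the ends need care: an advancing neighbour adds one end
    cell, while a held one keeps the old end cell, which lowers the gap by one if it burns on this
    turn. *)
Lemma gap_hold f b b' d lo hi h (aL aR : bool) :
    fire_step b b' d -> hull f b lo hi h ->
  (gap f b' (lo - aL%:Z) (hi + aR%:Z) h
     + ~~ aL * ~~ b (mk f lo h) + ~~ aR * ~~ b (mk f hi h) <=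
   gap f b lo hi h
     + ~~ b' (mk f (lo - aL%:Z) h) + ~~ b' (mk f (hi + aR%:Z) h))%N.
Proof.
move=> st hl; have lohi := hull_le hl.
have b'b x : (~~ b' (mk f x h) <= ~~ b (mk f x h))%N.
  by have := step_mono st (v := mk f x h); case: (b _) => [->|]; case: (b' _).
rewrite /gap (@zrange_cat (lo - 1) (lo - aL%:Z)); last by lia.
rewrite subrK (@zrange_cat hi lo (hi + aR%:Z)); last by lia.
rewrite !count_cat.
have -> : count (fun x => ~~ b' (mk f x h)) (zrange (lo - aL%:Z) (lo - 1)) =
    (aL * ~~ b' (mk f (lo - aL%:Z) h))%N.
  by case: aL; rewrite ?zrange1 //= ?mul1n ?addn0 // subr0 (_ : zrange _ _ = [::]) //
    /zrange (_ : absz _ = 0%N) //; lia.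
have -> : count (fun x => ~~ b' (mk f x h)) (zrange (hi + 1) (hi + aR%:Z)) =
    (aR * ~~ b' (mk f (hi + aR%:Z) h))%N.
  by case: aR; rewrite ?zrange1 //= ?mul1n ?addn0 // addr0 (_ : zrange _ _ = [::]) //
    /zrange (_ : absz _ = 0%N) //; lia.
have hl' : (count (fun x => ~~ b' (mk f x h)) (zrange lo hi)
   + ~~ b (mk f lo h) + ~~ b (mk f hi h) <=
   count (fun x => ~~ b (mk f x h)) (zrange lo hi)
   + ~~ b' (mk f lo h) + ~~ b' (mk f hi h))%N.
  have := gap_ends hl; have := gap_corners hl; rewrite /gap.
  case: (lo =P hi) => [<-|lo_hi].
    rewrite zrange1 /=; have := b'b lo; lia.
  rewrite (@zrange_cat lo lo hi); last by lia.
  rewrite (@zrange_cat (hi - 1) (lo + 1) hi); last by lia.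
  rewrite subrK !zrange1 !count_cat /= !addn0.
  set m := count (fun x => ~~ b' _) _; set n := count _ _.
  have : (m <= n)%N by apply: sub_count => x /=; have := b'b x; case: (b _); case: (b' _).
  lia.
have := b'b lo; have := b'b hi; case: (aL); case: (aR); rewrite ?mul1n ?mul0n ?subr0 ?addr0 //=; lia.
Qed.

(* Four lines rather than a ring of cells: saved cells lie within one step of
   the box, so those on one of the lines are in the ring around the box. *)
Definition outer_ring (x0 x1 y0 y1 : int) (v : cell) : bool :=
  [|| v.1 == x0 - 1, v.1 == x1 + 1, v.2 == y0 - 1 | v.2 == y1 + 1].

(** * The four sides and corners combined over a turn *)

Definition frame_n : frame.
Proof. by apply: (@Frame fst snd pair) => // -[]. Defined.

Definition frame_s : frame.
Proof.
apply: (@Frame fst (fun v => - v.2) (fun x h => (x, - h))) => //= [x h|[x y]|v w].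
- by rewrite opprK.
- by rewrite opprK.
- by rewrite /near; lia.
Defined.

Definition frame_e : frame.
Proof.
by apply: (@Frame snd fst (fun x h => (h, x))) => // [[]|v w] //; rewrite /near andbC.
Defined.

Definition frame_w : frame.
Proof.
apply: (@Frame snd (fun v => - v.1) (fun x h => (- h, x))) => //= [x h|[x y]|v w].
- by rewrite opprK.
- by rewrite opprK.
- by rewrite /near; lia.
Defined.

(** Inclusion-exclusion: parallel lines of the ring are disjoint, so only the four outer corner
    cells lie on two lines. *)
Lemma ring_count (d : seq cell) (x0 x1 y0 y1 : int) : uniq d ->
    x0 <= x1 -> y0 <= y1 ->
  (count (outer_ring x0 x1 y0 y1) d
    + ((x1 + 1, y1 + 1)%R \in d) + ((x0 - 1, y1 + 1)%R \in d)
    + ((x1 + 1, y0 - 1)%R \in d) + ((x0 - 1, y0 - 1)%R \in d) =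
   hits frame_n d y1 + hits frame_s d (- y0)%R
    + hits frame_e d x1 + hits frame_w d (- x0)%R)%N.
Proof.
move=> d_uniq x01 y01; rewrite -!count_uniq_mem // /hits /=.
have x_or x : ~~ ((x == x0 - 1) && (x == x1 + 1)) by lia.
have y_or y : ~~ ((y == y0 - 1) && (y == y1 + 1)) by lia.
have west x : (- x == - x0 + 1) = (x == x0 - 1) by lia.
have south y : (- y == - y0 + 1) = (y == y0 - 1) by lia.
elim: d {d_uniq} => //= -[x y] d; rewrite /outer_ring /= !xpair_eqE west south.
case: (x == x0 - 1) (x == x1 + 1) (x_or x) => -[] // _;
  case: (y == y0 - 1) (y == y1 + 1) (y_or y) => -[] // _; clear; lia.
Qed.

Lemma hits_corners (d : seq cell) (x0 x1 y0 y1 : int) : uniq d ->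
    x0 <= x1 -> y0 <= y1 ->
  [/\ ((x0 - 1, y1 + 1)%R \in d) + ((x1 + 1, y1 + 1)%R \in d) <= hits frame_n d y1,
      ((x0 - 1, y0 - 1)%R \in d) + ((x1 + 1, y0 - 1)%R \in d) <= hits frame_s d (- y0)%R,
      ((x1 + 1, y0 - 1)%R \in d) + ((x1 + 1, y1 + 1)%R \in d) <= hits frame_e d x1
    & ((x0 - 1, y0 - 1)%R \in d) + ((x0 - 1, y1 + 1)%R \in d) <= hits frame_w d (- x0)%R]%N.
Proof.
move=> d_uniq x01 y01; rewrite -!count_uniq_mem // /hits /=.
by elim: d {d_uniq} => [|[x y] d [? ? ? ?]] //=; split; rewrite !xpair_eqE; lia.
Qed.

(** Lets the list of saved cells grow between turns: each new cell raises a count by at most one and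
    the size by one. *)
Lemma count_extend (T : eqType) (a : pred T) (d d' : seq T) :
  uniq d -> uniq d' -> {subset d <= d'} ->
  (count a d' + size d <= count a d + size d')%N.
Proof.
move=> d_uniq d'_uniq dd'.
have /permP/(_ _) d'E : perm_eq d' (d ++ filter (predC (mem d)) d').
  apply: uniq_perm => //.
    rewrite cat_uniq d_uniq filter_uniq // andbT; apply/hasPn => x.
    by rewrite mem_filter => /andP[].
  move=> x; rewrite mem_cat mem_filter /=.
  by case: (boolP (x \in d)) => // /dd' ->.
rewrite d'E -[size d'](count_predT d') d'E !count_cat !count_predT.
have := count_size a (filter (predC (mem d)) d'); lia.
Qed.

(** The fire moves at most one row, and if it does not move, the old top cell still burns. The ends
    [lo'] and [hi'] are left open because they depend on the neighbouring sides, treated in other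
    frames. *)
Lemma hull_advance f b b' d lo hi h : fire_step b b' d -> hull f b lo hi h ->
  exists a : bool, (forall v, b' v -> height f v <= h + a%:Z) /\
    forall lo' hi', lo' <= lo -> hi <= hi' ->
      (forall v, b' v -> lo' <= along f v <= hi') -> hull f b' lo' hi' (h + a%:Z).
Proof.
move=> st [b_in [x x_in bx]].
have le_h1 v : b' v -> height f v <= h + 1.
  by case/(step_near st) => w /b_in; rewrite (near_frame f); lia.
case: (pselect (exists2 v, b' v & height f v = h + 1)) => [[v b'v hv]|no].
  exists true; split => // lo' hi' _ _ b'_in; split.
    by move=> w b'w; have := b'_in _ b'w; have := le_h1 _ b'w; lia.
  exists (along f v); first exact: b'_in.
  by rewrite -[h + _]hv mkK.
have le_h v : b' v -> height f v <= h.
  move=> b'v; have := le_h1 _ b'v; case: (eqVneq (height f v) (h + 1)); last by lia.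
  by move=> hv; case: no; exists v.
exists false; rewrite addr0; split => // lo' hi' lo'lo hihi' b'_in; split.
  by move=> w b'w; have := b'_in _ b'w; have := le_h _ b'w; lia.
by exists x; [lia|apply: (step_mono st)].
Qed.

(* Bookkeeping of a turn on one side of the bounding box, of length [len + 1]:
   [a] tells whether the side advances, [aL] and [aR] whether its neighbours do.
   There are [g] unburnt cells on the side and [k] saved cells just outside;
   [g'] and [k'] are the same quantities for the new box, and [cL], [cR], [cL'],
   [cR'] tell whether the end cells of the side are unburnt. *)
Definition side_turn (a aL aR : bool) (len : int)
    (g k g' k' cL cR cL' cR' : nat) : bool :=
  if a then (g' + ~~ aL + ~~ aR <= g + k)%N && (k' == 0%N)
  else [&& len + 3 <= (g + k)%:Z,
           (g' + ~~ aL * cL + ~~ aR * cR <= g + cL' + cR')%N & k' == k].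

Lemma side_step f b b' d lo hi h (aL aR a : bool) lo' hi' h' :
    fire_step b b' d -> hull f b lo hi h ->
    lo' = lo - aL%:Z -> hi' = hi + aR%:Z -> h' = h + a%:Z ->
    hull f b' lo' hi' h' ->
  side_turn a aL aR (hi - lo) (gap f b lo hi h) (hits f d h)
    (gap f b' lo' hi' h') (hits f d h') (~~ b (mk f lo h)) (~~ b (mk f hi h))
    (~~ b' (mk f lo' h')) (~~ b' (mk f hi' h')).
Proof.
move=> st hl -> -> -> hl'; have b'_in := hull_in hl'; rewrite /side_turn.
case: a b'_in {hl'} => b'_in.
  apply/andP; split.
    by apply: gap_advance => // v /b'_in; lia.
  (* Saved cells are near cells that burned before the turn, so none lies beyond the row just
     entered. *)
  rewrite /hits eqn0Ngt -has_count; apply/hasPn => v /(saved_near st)[w bw].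
  by have := hull_in hl bw; rewrite (near_frame f); lia.
rewrite addr0 eqxx andbT; apply/andP; split; last exact: (gap_hold aL aR st hl).
by apply: (held_cost st hl) => v /b'_in; lia.
Qed.

(* The same at a corner: [c] tells whether the corner cell of the box is
   unburnt, and [s] whether the cell diagonally outside it is saved. *)
Definition corner_turn (a1 a2 : bool) (c s c' s' : nat) : bool :=
  (c + s <= 1)%N &&
  (if a1 && a2 then c' == (c + s)%N else (a1 || a2) || (c' <= c)%N && (s' == s)).

Definition outer_corner (b : pred cell) (w z : cell) : Prop :=
  near w z /\ forall v, b v -> near v z -> v = w.

(** Only [w] can ignite [z]. So [z] stays unburnt exactly when [w] is unburnt or [z] is saved, and
    these exclude each other because a saved cell has a burning neighbour. *)
Lemma corner_step b b' d (w z w' z' : cell) (a1 a2 : bool) :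
    fire_step b b' d -> outer_corner b w z ->
    (a1 && a2 -> w' = z) -> (~~ a1 -> ~~ a2 -> w' = w /\ z' = z) ->
  corner_turn a1 a2 (~~ b w) (z \in d) (~~ b' w') (z' \in d).
Proof.
move=> st [wz only] both none.
have c's : (~~ b' z = ~~ b w + (z \in d) :> nat)%N.
  case: (boolP (b w)) => bw /=.
    have := step_spread st bw wz; have := saved_unburnt st (v := z).
    by case: (z \in d) => [/(_ isT)/negbTE ->|_] //=; rewrite orbF => ->.
  have nb : ~ exists2 v, b v & near v z.
    by case=> v bv vz; move: bw; rewrite -(only v bv vz) bv.
  case: (boolP (b' z)) => [/(step_near st)//|_].
  by case: (boolP (z \in d)) => [/(saved_near st)|].
rewrite /corner_turn -c's leq_b1 /=.
case: a1 a2 both none => -[] //= both none.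
  by rewrite both.
have [-> ->] := none isT isT; rewrite eqxx andbT.
by have := step_mono st (v := w); case: (b w) => [->|]; case: (b' w).
Qed.

Lemma box_outer_corners (b : pred cell) (x0 x1 y0 y1 : int) :
    (forall v, b v -> (x0 <= v.1 <= x1) && (y0 <= v.2 <= y1)) ->
  [/\ outer_corner b (x0, y0) (x0 - 1, y0 - 1),
      outer_corner b (x0, y1) (x0 - 1, y1 + 1),
      outer_corner b (x1, y0) (x1 + 1, y0 - 1)
    & outer_corner b (x1, y1) (x1 + 1, y1 + 1)].
Proof.
move=> b_in; split; split; rewrite ?/near /=; try lia;
  by move=> [x y] /b_in /= xy; rewrite /near /= => nxy; congr (_, _); lia.
Qed.

(** Preservation of [inv_all] while the list of saved cells is fixed: by [ring_count], hits less
    saved outer corners count the outer ring. *)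
Lemma turn_all (aW aE aS aN : bool) (lx ly : int)
    (gn gs ge gw kn ks ke kw gn' gs' ge' gw' kn' ks' ke' kw' : nat)
    (c00 c01 c10 c11 c00' c01' c10' c11' : nat)
    (s00 s01 s10 s11 s00' s01' s10' s11' : nat) :
    side_turn aN aW aE lx gn kn gn' kn' c01 c11 c01' c11' ->
    side_turn aS aW aE lx gs ks gs' ks' c00 c10 c00' c10' ->
    side_turn aE aS aN ly ge ke ge' ke' c10 c11 c10' c11' ->
    side_turn aW aS aN ly gw kw gw' kw' c00 c01 c00' c01' ->
    corner_turn aW aS c00 s00 c00' s00' -> corner_turn aW aN c01 s01 c01' s01' ->
    corner_turn aE aS c10 s10 c10' s10' -> corner_turn aE aN c11 s11 c11' s11' ->
  (gn' + gs' + ge' + gw' + (kn' + ks' + ke' + kw')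
     + (c00 + c01 + c10 + c11) + (s00 + s01 + s10 + s11) <=
   gn + gs + ge + gw + (kn + ks + ke + kw)
     + (c00' + c01' + c10' + c11') + (s00' + s01' + s10' + s11'))%N.
Proof.
rewrite /side_turn /corner_turn.
by case: aW; case: aE; case: aS; case: aN => /=; rewrite ?mul1n ?mul0n; lia.
Qed.

(** Each of the two sides separately loses two by advancing and regains at most one per advancing
    neighbour, for a longer row or an unburnt new corner. Where side and neighbour are both held,
    [c' <= c] rules out a gain. *)
Lemma turn_opposite (aW aE aS aN : bool) (lx : int)
    (gn gs kn ks gn' gs' kn' ks' : nat)
    (c00 c01 c10 c11 c00' c01' c10' c11' : nat)
    (s00 s01 s10 s11 s00' s01' s10' s11' : nat) :
    (c00' <= 1)%N -> (c01' <= 1)%N -> (c10' <= 1)%N -> (c11' <= 1)%N ->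
    side_turn aN aW aE lx gn kn gn' kn' c01 c11 c01' c11' ->
    side_turn aS aW aE lx gs ks gs' ks' c00 c10 c00' c10' ->
    corner_turn aW aS c00 s00 c00' s00' -> corner_turn aW aN c01 s01 c01' s01' ->
    corner_turn aE aS c10 s10 c10' s10' -> corner_turn aE aN c11 s11 c11' s11' ->
  (gn' + gs' + kn' + ks' + (aN + aS).*2 <=
   gn + gs + kn + ks + (aW + aE).*2)%N.
Proof.
rewrite /side_turn /corner_turn.
by case: aW; case: aE; case: aS; case: aN => /=; rewrite ?mul1n ?mul0n; lia.
Qed.

(** [D] counts the saved cells and [R] those on the ring. If two adjacent sides are held, the corner
    bounds on the other two leave at most one unit over, so [lx + ly + 5 <= D]. If north and south
    are held, the ring balance gives [2 * lx + 6 <= D] and the invariant of the pair gives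
    [2 * ly + 6 <= D]; east and west are symmetric. In each case [D] exceeds [3 * t + 3]. *)
Lemma turn_three_sides (aW aE aS aN : bool) (lx ly : int) (t D R : nat)
    (gn gs ge gw kn ks ke kw gn' gs' ge' gw' kn' ks' ke' kw' : nat)
    (c00 c01 c10 c11 c00' c01' c10' c11' : nat)
    (s00 s01 s10 s11 s00' s01' s10' s11' : nat) :
    side_turn aN aW aE lx gn kn gn' kn' c01 c11 c01' c11' ->
    side_turn aS aW aE lx gs ks gs' ks' c00 c10 c00' c10' ->
    side_turn aE aS aN ly ge ke ge' ke' c10 c11 c10' c11' ->
    side_turn aW aS aN ly gw kw gw' kw' c00 c01 c00' c01' ->
    corner_turn aW aS c00 s00 c00' s00' -> corner_turn aW aN c01 s01 c01' s01' ->
    corner_turn aE aS c10 s10 c10' s10' -> corner_turn aE aN c11 s11 c11' s11' ->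
    (c01 + c11 <= gn)%N -> (c00 + c10 <= gs)%N ->
    (c10 + c11 <= ge)%N -> (c00 + c01 <= gw)%N ->
    (s01 + s11 <= kn)%N -> (s00 + s10 <= ks)%N ->
    (s10 + s11 <= ke)%N -> (s00 + s01 <= kw)%N ->
    (gn + gs + ge + gw + R <= D + (c00 + c01 + c10 + c11))%N ->
    (R + (s00 + s01 + s10 + s11) = kn + ks + ke + kw)%N ->
    (gn + gs + kn + ks)%:Z + ly *+ 2 <= D%:Z + lx *+ 2 ->
    (ge + gw + ke + kw)%:Z + lx *+ 2 <= D%:Z + ly *+ 2 ->
    (3 * t)%:Z <= lx + ly -> (D <= 3 * t.+1)%N ->
  (2 < aW + aE + aS + aN)%N.
Proof.
rewrite /side_turn /corner_turn.
case: aW; case: aE; case: aS; case: aN => //=; rewrite ?mul1n ?mul0n ?mulr2n; lia.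
Qed.

(** With one predicate for a pair of lines, [count_extend] charges a new cell once for the pair. *)
Lemma opposite_hits (e : seq cell) (x0 x1 y0 y1 : int) : x0 <= x1 -> y0 <= y1 ->
  count (fun v : cell => (v.2 == y1 + 1) || (v.2 == y0 - 1)) e =
    (hits frame_n e y1 + hits frame_s e (- y0)%R)%N /\
  count (fun v : cell => (v.1 == x1 + 1) || (v.1 == x0 - 1)) e =
    (hits frame_e e x1 + hits frame_w e (- x0)%R)%N.
Proof.
move=> x01 y01; rewrite /hits /=.
by elim: e => //= v e [IHy IHx]; split; lia.
Qed.

(** * The invariant and its preservation *)

(* [inv_all] survives every turn: a stretch of unburnt cells around a corner of
   the box may lose cells on one side and gain as many on the other, but never
   gets longer in total without new saved cells. In [inv_ns] and [inv_ew], such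
   transfers are compensated by the change of shape of the box. *)
Record box_invariant (t : nat) (b : pred cell) (d : seq cell)
    (x0 x1 y0 y1 : int) : Prop := Invariant {
  inv_n : hull frame_n b x0 x1 y1;
  inv_s : hull frame_s b x0 x1 (- y0);
  inv_e : hull frame_e b y0 y1 x1;
  inv_w : hull frame_w b y0 y1 (- x0);
  inv_all :
    (gap frame_n b x0 x1 y1 + gap frame_s b x0 x1 (- y0)%R
     + gap frame_e b y0 y1 x1 + gap frame_w b y0 y1 (- x0)%R
     + count (outer_ring x0 x1 y0 y1) d <=
     size d
     + (~~ b (x0, y0) + ~~ b (x0, y1) + ~~ b (x1, y0) + ~~ b (x1, y1)))%N;
  inv_ns :
    (gap frame_n b x0 x1 y1 + gap frame_s b x0 x1 (- y0)%R
     + hits frame_n d y1 + hits frame_s d (- y0)%R)%:Z + (y1 - y0) *+ 2 <=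
    (size d)%:Z + (x1 - x0) *+ 2;
  inv_ew :
    (gap frame_e b y0 y1 x1 + gap frame_w b y0 y1 (- x0)%R
     + hits frame_e d x1 + hits frame_w d (- x0)%R)%:Z + (x1 - x0) *+ 2 <=
    (size d)%:Z + (y1 - y0) *+ 2;
  inv_size : (3 * t)%:Z <= (x1 - x0) + (y1 - y0) }.

Lemma mk_frames (x y : int) :
  ((mk frame_n x y = (x, y)) * (mk frame_s x (- y) = (x, y))) *
  ((mk frame_e y x = (x, y)) * (mk frame_w y (- x) = (x, y))).
Proof. by rewrite /= !opprK. Qed.

Lemma hull_step b b' d (x0 x1 y0 y1 : int) : fire_step b b' d ->
    hull frame_n b x0 x1 y1 -> hull frame_s b x0 x1 (- y0) ->
    hull frame_e b y0 y1 x1 -> hull frame_w b y0 y1 (- x0) ->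
  exists aW aE aS aN : bool,
    let x0' := x0 - aW%:Z in let x1' := x1 + aE%:Z in
    let y0' := y0 - aS%:Z in let y1' := y1 + aN%:Z in
    [/\ hull frame_n b' x0' x1' y1', hull frame_s b' x0' x1' (- y0'),
        hull frame_e b' y0' y1' x1' & hull frame_w b' y0' y1' (- x0')].
Proof.
move=> st hn hs he hw.
have [aN [b'N hn']] := hull_advance st hn.
have [aS [b'S hs']] := hull_advance st hs.
have [aE [b'E he']] := hull_advance st he.
have [aW [b'W hw']] := hull_advance st hw.
exists aW, aE, aS, aN; move: b'N b'S b'E b'W => /= b'N b'S b'E b'W.
have b'x v : b' v -> x0 - aW%:Z <= v.1 <= x1 + aE%:Z.
  by move=> b'v; move: (b'W _ b'v) (b'E _ b'v); clear; lia.
have b'y v : b' v -> y0 - aS%:Z <= v.2 <= y1 + aN%:Z.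
  by move=> b'v; move: (b'S _ b'v) (b'N _ b'v); clear; lia.
have le_widen (x : int) (a : bool) : (x - a%:Z <= x) * (x <= x + a%:Z).
  by rewrite gerBl lerDl.
by split; rewrite ?opprD ?opprK; (apply: hn' || apply: hs' || apply: he' || apply: hw'); rewrite ?le_widen.
Qed.

Lemma account_all (D D' R R0 R' gn gs ge gw kn ks ke kw : nat)
    (gn' gs' ge' gw' kn' ks' ke' kw' : nat)
    (c00 c01 c10 c11 c00' c01' c10' c11' : nat)
    (s00 s01 s10 s11 s00' s01' s10' s11' : nat) :
  (gn' + gs' + ge' + gw' + (kn' + ks' + ke' + kw')
     + (c00 + c01 + c10 + c11) + (s00 + s01 + s10 + s11) <=
   gn + gs + ge + gw + (kn + ks + ke + kw)
     + (c00' + c01' + c10' + c11') + (s00' + s01' + s10' + s11'))%N ->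
  (gn + gs + ge + gw + R <= D + (c00 + c01 + c10 + c11))%N ->
  (R + s11 + s01 + s10 + s00 = kn + ks + ke + kw)%N ->
  (R0 + s11' + s01' + s10' + s00' = kn' + ks' + ke' + kw')%N ->
  (R' + D <= R0 + D')%N ->
  (gn' + gs' + ge' + gw' + R' <= D' + (c00' + c01' + c10' + c11'))%N.
Proof. lia. Qed.

Lemma account_opposite (D D' a c gn gs kn ks gn' gs' k0n k0s kn' ks' : nat)
    (lx ly lx' ly' : int) :
  (gn' + gs' + k0n + k0s + a.*2 <= gn + gs + kn + ks + c.*2)%N ->
  (gn + gs + kn + ks)%:Z + ly *+ 2 <= D%:Z + lx *+ 2 ->
  (kn' + ks' + D <= k0n + k0s + D')%N ->
  lx' = lx + c%:Z -> ly' = ly + a%:Z ->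
  (gn' + gs' + kn' + ks')%:Z + ly' *+ 2 <= D'%:Z + lx' *+ 2.
Proof. rewrite !mulr2n; lia. Qed.

Lemma invariant_step t b b' d d' x0 x1 y0 y1 :
    box_invariant t b d x0 x1 y0 y1 -> fire_step b b' d ->
    uniq d' -> {subset d <= d'} -> (size d <= 3 * t.+1)%N ->
  exists aW aE aS aN : bool, (2 < aW + aE + aS + aN)%N /\
    box_invariant t.+1 b' d' (x0 - aW%:Z) (x1 + aE%:Z) (y0 - aS%:Z) (y1 + aN%:Z).
Proof.
move=> [hn hs he hw iall ins iew isz] st d'_uniq dd' sized.
have d_uniq := saved_uniq st.
have [aW [aE [aS [aN []]]]] := hull_step st hn hs he hw.
set x0' := x0 - _; set x1' := x1 + _; set y0' := y0 - _; set y1' := y1 + _.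
move=> hn' hs' he' hw'; exists aW, aE, aS, aN.
have y0'E : - y0' = - y0 + aS%:Z by rewrite opprD opprK.
have x0'E : - x0' = - x0 + aW%:Z by rewrite opprD opprK.
have x01 := hull_le hn; have y01 := hull_le he.
have x01' := hull_le hn'; have y01' := hull_le he'.
have b_in v : b v -> (x0 <= v.1 <= x1) && (y0 <= v.2 <= y1).
  move=> bv; have /= := hull_in hn bv; have /= := hull_in he bv; clear; lia.
have sn := side_step st hn (erefl x0') (erefl x1') (erefl y1') hn'.
have ss := side_step st hs (erefl x0') (erefl x1') y0'E hs'.
have se := side_step st he (erefl y0') (erefl y1') (erefl x1') he'.
have sw := side_step st hw (erefl y0') (erefl y1') x0'E hw'.
rewrite !mk_frames in sn ss se sw.
have gn := gap_corners hn; have gs := gap_corners hs.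
have ge := gap_corners he; have gw := gap_corners hw.
rewrite !mk_frames in gn gs ge gw.
have [o00 o01 o10 o11] := box_outer_corners b_in.
have corner := corner_step st.
have c00 : corner_turn aW aS (~~ b (x0, y0)) ((x0 - 1, y0 - 1) \in d)
    (~~ b' (x0', y0')) ((x0' - 1, y0' - 1) \in d).
  by apply: corner o00 _ _; rewrite /x0' /y0'; case: (aW); case: (aS) => //; rewrite !subr0.
have c01 : corner_turn aW aN (~~ b (x0, y1)) ((x0 - 1, y1 + 1) \in d)
    (~~ b' (x0', y1')) ((x0' - 1, y1' + 1) \in d).
  by apply: corner o01 _ _; rewrite /x0' /y1'; case: (aW); case: (aN) => //; rewrite subr0 addr0.
have c10 : corner_turn aE aS (~~ b (x1, y0)) ((x1 + 1, y0 - 1) \in d)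
    (~~ b' (x1', y0')) ((x1' + 1, y0' - 1) \in d).
  by apply: corner o10 _ _; rewrite /x1' /y0'; case: (aE); case: (aS) => //; rewrite subr0 addr0.
have c11 : corner_turn aE aN (~~ b (x1, y1)) ((x1 + 1, y1 + 1) \in d)
    (~~ b' (x1', y1')) ((x1' + 1, y1' + 1) \in d).
  by apply: corner o11 _ _; rewrite /x1' /y1'; case: (aE); case: (aN) => //; rewrite !addr0.
have rc := ring_count d_uniq x01 y01; have rc' := ring_count d_uniq x01' y01'.
have [kn ks ke kw] := hits_corners d_uniq x01 y01.
have three : (2 < aW + aE + aS + aN)%N.
  apply: (turn_three_sides sn ss se sw c00 c01 c10 c11 gn gs ge gw kn ks ke kw iall _ ins iew isz sized) => //.
  by rewrite -rc; clear; lia.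
have all := turn_all sn ss se sw c00 c01 c10 c11.
have ns := turn_opposite (leq_b1 _) (leq_b1 _) (leq_b1 _) (leq_b1 _) sn ss c00 c01 c10 c11.
have corner_sym a1 a2 c s c' s' : corner_turn a1 a2 c s c' s' -> corner_turn a2 a1 c s c' s'.
  by case: a1 a2 => -[].
(* Exchanging the axes swaps the north-west and south-east corners. *)
have ew := turn_opposite (leq_b1 _) (leq_b1 _) (leq_b1 _) (leq_b1 _) se sw
  (corner_sym _ _ _ _ _ _ c00) (corner_sym _ _ _ _ _ _ c10)
  (corner_sym _ _ _ _ _ _ c01) (corner_sym _ _ _ _ _ _ c11).
have extR := count_extend (outer_ring x0' x1' y0' y1') d_uniq d'_uniq dd'.
have extN := count_extend (fun v : cell => (v.2 == y1' + 1) || (v.2 == y0' - 1))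
  d_uniq d'_uniq dd'.
have extE := count_extend (fun v : cell => (v.1 == x1' + 1) || (v.1 == x0' - 1))
  d_uniq d'_uniq dd'.
have [eN eE] := opposite_hits d x01' y01'.
have [eN' eE'] := opposite_hits d' x01' y01'.
rewrite eN eN' in extN; rewrite eE eE' in extE.
split=> //; split=> //.
- by apply: account_all all iall rc rc' extR.
- by apply: (account_opposite ns ins extN); rewrite /x0' /x1' /y0' /y1'; clear; lia.
- by apply: (account_opposite ew iew extE); rewrite /x0' /x1' /y0' /y1'; clear; lia.
- move: isz three; rewrite /y1' /y0' /x1' /x0'; clear; lia.
Qed.

Lemma hull_height f b lo hi h lo' hi' h' :
  hull f b lo hi h -> hull f b lo' hi' h' -> h = h'.
Proof.
move=> [b_in [x _ bx]] [b_in' [x' _ bx']].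
have := b_in _ bx'; have := b_in' _ bx; rewrite !mk_height; lia.
Qed.

(** For a single cell the gaps and lengths vanish, and what remains are counts of elements of
    [d]. *)
Lemma invariant_init (u : cell) (d : seq cell) :
  box_invariant 0%N (pred1 u) d u.1 u.1 u.2 u.2.
Proof.
have hn : hull frame_n (pred1 u) u.1 u.1 u.2.
  split=> [v /eqP ->|] /=; first by rewrite !lexx.
  by exists u.1; rewrite ?lexx //= -surjective_pairing.
have hs : hull frame_s (pred1 u) u.1 u.1 (- u.2).
  split=> [v /eqP ->|] /=; first by rewrite !lexx.
  by exists u.1; rewrite ?lexx //= opprK -surjective_pairing.
have he : hull frame_e (pred1 u) u.2 u.2 u.1.
  split=> [v /eqP ->|] /=; first by rewrite !lexx.
  by exists u.2; rewrite ?lexx //= -surjective_pairing.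
have hw : hull frame_w (pred1 u) u.2 u.2 (- u.1).
  split=> [v /eqP ->|] /=; first by rewrite !lexx.
  by exists u.2; rewrite ?lexx //= opprK -surjective_pairing.
have [ns ew] := opposite_hits d (lexx u.1) (lexx u.2).
split=> //; rewrite ?(gap_ends hn) ?(gap_ends hs) ?(gap_ends he) ?(gap_ends hw).
- by rewrite !eqxx !add0n; apply: leq_trans (count_size _ _) (leq_addr _ _).
- by rewrite !eqxx !add0n -ns !subrr !mul0rn !addr0 lez_nat count_size.
- by rewrite !eqxx !add0n -ew !subrr !mul0rn !addr0 lez_nat count_size.
- by rewrite !subrr.
Qed.

(** * From the game to the invariant: the lower bound *)

Lemma strong_adj_near (v w : cell) : strong_adj v w = (v != w) && near v w.
Proof. by []. Qed.

Lemma near_refl v : near v v.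
Proof. by rewrite /near !subrr normr0. Qed.

Lemma protectedS (G : sgraph) k (pos : positions G k) s t : (s <= t)%N ->
  (protected pos s `<=` protected pos t)%classic.
Proof. by move=> st v [r [i [rs <-]]]; exists r, i; split=> //; apply: leq_trans st. Qed.

(** Positions are arbitrary here and may be burning, hence the first condition of the filter. *)
Definition saved (k : nat) (u : strong_grid) (pos : positions strong_grid k) (t : nat) :
    seq cell :=
  undup [seq v <- [seq pos s i | s <- iota 0 t.+1, i <- enum 'I_k]
        | `[< ~ burning u pos t.+1 v /\
              exists2 w : strong_grid, burning u pos t w & near w v >]].

Lemma mem_saved k (u : strong_grid) (pos : positions strong_grid k) t v :
  v \in saved u pos t <->
  [/\ protected pos t v, ~ burning u pos t.+1 v
    & exists2 w : strong_grid, burning u pos t w & near w v].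
Proof.
rewrite mem_undup mem_filter; split.
  case/andP=> /asboolP[nb nw] /allpairsP[[s i] []].
  by rewrite mem_iota ltnS => /= st _ vE; split=> //; exists s, i.
case=> -[s [i [st <-]]] nb nw; apply/andP; split; first exact/asboolP.
by apply/allpairsP; exists (s, i); rewrite mem_iota mem_enum.
Qed.

Lemma size_saved k (u : strong_grid) (pos : positions strong_grid k) t :
  (size (saved u pos t) <= t.+1 * k)%N.
Proof.
apply: leq_trans (size_undup _) _; rewrite size_filter.
apply: leq_trans (count_size _ _) _.
by rewrite size_allpairs size_iota size_enum_ord.
Qed.

Lemma burning_step k (u : strong_grid) (pos : positions strong_grid k) t :
  fire_step (fun v => `[< burning u pos t v >])
    (fun v => `[< burning u pos t.+1 v >]) (saved u pos t).
Proof.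
split.
- by move=> v /asboolP bv; apply/asboolP; left.
- move=> v /asboolP[bv|[_ _ [w bw wv]]]; [exists v|exists w] => //;
    try exact/asboolP; first exact: near_refl.
  by case/andP: wv.
- move=> w v /asboolP bw wv; apply/orP.
  case: (pselect (burning u pos t.+1 v)) => [bv|nbv]; [left|right].
    exact/asboolP.
  apply/mem_saved; split=> //; last by exists w.
  apply: contrapT => npv; apply: nbv.
  case: (pselect (burning u pos t v)) => bv; [by left|right; split=> //].
  exists w => //; rewrite /= strong_adj_near wv andbT.
  by apply/eqP => wEv; apply: bv; rewrite -wEv.
- by move=> v /mem_saved[_ nbv _]; apply/asboolP.
- by move=> v /mem_saved[_ _ [w bw wv]]; exists w => //; apply/asboolP.
- exact: undup_uniq.
Qed.

Lemma saved_mono k (u : strong_grid) (pos : positions strong_grid k) t :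
  {subset saved u pos t <= saved u pos t.+1}.
Proof.
move=> v /mem_saved[pv nbv [w bw wv]]; apply/mem_saved; split.
- by apply: protectedS pv.
- by case=> // -[_ + _]; apply; apply: protectedS pv.
- by exists w => //; left.
Qed.

Lemma burning_invariant k (u : strong_grid) (pos : positions strong_grid k) t : (k <= 3)%N ->
  exists x0 x1 y0 y1 : int,
    box_invariant t (fun v => `[< burning u pos t v >]) (saved u pos t) x0 x1 y0 y1.
Proof.
move=> k3; elim: t => [|t [x0 [x1 [y0 [y1 inv]]]]].
  exists u.1, u.1, u.2, u.2.
  rewrite (_ : (fun v => _) = pred1 u :> pred cell); first exact: invariant_init.
  by apply/funext => v; apply/asboolP/eqP.
have [|aW [aE [aS [aN [_ inv']]]]] :=
  invariant_step inv (burning_step u pos t) (undup_uniq _) (saved_mono (t := t)).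
  by apply: leq_trans (size_saved _ _ _) _; rewrite mulnC leq_mul2r k3 orbT.
by eexists _, _, _, _; exact: inv'.
Qed.

(** If nothing is threatened, the fire is the same one turn later, so by [hull_height] no side
    advances, whereas [invariant_step] makes three advance. *)
Lemma three_not_contained k (u : strong_grid) (pos : positions strong_grid k) : (k <= 3)%N ->
  ~ contained u pos.
Proof.
move=> k3 [t no_threat].
have [x0 [x1 [y0 [y1 inv]]]] := burning_invariant u pos t k3.
have [|aW [aE [aS [aN [three inv']]]]] :=
  invariant_step inv (burning_step u pos t) (undup_uniq _) (saved_mono (t := t)).
  by apply: leq_trans (size_saved _ _ _) _; rewrite mulnC leq_mul2r k3 orbT.
have bE : (fun v => `[< burning u pos t.+1 v >]) =
    (fun v => `[< burning u pos t v >]) :> pred cell.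
  apply/funext => v; apply/asbool_equiv_eq; split=> [[//|]|]; last by left.
  by rewrite no_threat.
case: inv' => hn' hs' he' hw' _ _ _ _; rewrite bE in hn' hs' he' hw'.
have := hull_height (inv_n inv) hn'; have := hull_height (inv_s inv) hs'.
have := hull_height (inv_e inv) he'; have := hull_height (inv_w inv) hw'.
move: three; clear; lia.
Qed.

(** * The strategy of four firefighters *)

(* Positions relative to the origin of the fire: firefighter 3 extends the
   northern wall westwards; firefighters 0 and 1 leapfrog clockwise along the
   northern, eastern, southern and western walls; firefighter 2 starts the
   eastern wall, cuts across to the west end of the southern wall, and extends
   it westwards. *)
Definition tour (t : nat) (i : nat) : cell :=
  let n := t%:Z in
  match i with
  | 0%N => if t == 0%N then (0, 1) else if t == 1%N then (2, 1)
         else if (t <= 7)%N then (2, 3 - 2 * n)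
         else if (t <= 24)%N then (18 - 2 * n, -13) else (-32, 2 * n - 62)
  | 1%N => if t == 0%N then (1, 1) else if t == 1%N then (2, 0)
         else if (t <= 7)%N then (2, 2 - 2 * n)
         else if (t <= 24)%N then (17 - 2 * n, -13) else (-32, 2 * n - 61)
  | 2%N => if (t <= 2)%N then (2, - 1 - n)
         else if (t <= 7)%N then (6 - 2 * n, 1 - 2 * n) else (- 1 - n, -13)
  | _ => (- 1 - n, 1)
  end.

Definition plan (t i : nat) : cell := tour (minn t 31) i.

Definition in_box (v : cell) : bool := (-31 <= v.1 <= 1) && (-12 <= v.2 <= 0).

(** The extent of an unhindered fire after turn [t]. *)
Definition in_ball (t : nat) (v : cell) : bool :=
  (absz v.1 <= t)%N && (absz v.2 <= t)%N.

Definition wall : seq cell :=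
  [seq v <- [seq (x, y) | x <- zrange (-32) 2, y <- zrange (-13) 1] | ~~ in_box v].

Definition neighbours (v : cell) : seq cell :=
  [seq (x, y) | x <- zrange (v.1 - 1) (v.1 + 1), y <- zrange (v.2 - 1) (v.2 + 1)].

(** A cell at distance [r] from the origin can burn on turn [r] at the earliest, and the spread on
    that turn respects protection up to turn [r - 1]; hence the strict bound on [s]. *)
Lemma wall_in_time :
  all (fun v => has (fun s => has (fun i => plan s i == v) (iota 0 4))
                    (iota 0 (maxn (absz v.1) (absz v.2)))) wall.
Proof. by vm_compute. Qed.

(** A computable sufficient condition for being unburnt, justified by [burning_dry]. *)
Definition dry (t : nat) (v : cell) : bool := ~~ (in_box v && in_ball t v).

(** Dryness is tested at [t.+1] because the fire spreads before the move. The midpoint [m] may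
    coincide with either end. *)
Lemma plan_moves :
  all (fun t => all (fun i => [&& dry t.+1 (plan t i), dry t.+1 (plan t.+1 i)
     & has (fun m => dry t.+1 m && near m (plan t.+1 i)) (neighbours (plan t i))])
     (iota 0 4)) (iota 0 31).
Proof. by vm_compute. Qed.

Lemma plan_end : all (fun i => ~~ in_box (plan 31 i)) (iota 0 4).
Proof. by vm_compute. Qed.

(** While some vertex is threatened, the number of burning elements of [L] grows each turn, which
    cannot go on beyond [size L]. *)
Lemma bounded_contained k (u : strong_grid) (pos : positions strong_grid k)
    (L : seq cell) :
  (forall t (v : strong_grid), burning u pos t v -> (v : cell) \in L) ->
  contained u pos.
Proof.
move=> bL; apply: contrapT => never.
pose b t (v : cell) := `[< burning u pos t v >].
have grow t : (count (b t) L < count (b t.+1) L)%N.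
  case: (pselect (exists v, threatened (burning u pos t) (protected pos t) v)); last first.
    by move=> no; case: never; exists t; apply/seteqP; split=> // v tv; case: no; exists v.
  case=> v tv; have [nbv _ _] := tv.
  have vL : v \in L by apply: (bL t.+1); right.
  have /permP cE := perm_to_rem vL; rewrite !cE /=.
  have -> : b t v = false by apply/asboolP.
  have -> : b t.+1 v by apply/asboolP; right.
  by rewrite add0n add1n ltnS; apply: sub_count => w /asboolP bw; apply/asboolP; left.
have le_count t : (t <= count (b t) L)%N.
  by elim: t => // t IH; apply: leq_ltn_trans IH (grow t).
by have := leq_trans (le_count (size L).+1) (count_size _ _); rewrite ltnn.
Qed.

Definition origin_shift (u v : cell) : cell := (v.1 - u.1, v.2 - u.2).

Definition plan_at (u : cell) : positions strong_grid 4 :=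
  fun t i => (u.1 + (plan t i).1, u.2 + (plan t i).2).

Lemma shift_plan_at u t i : origin_shift u (plan_at u t i) = plan t i.
Proof. by rewrite /origin_shift /= !(addrC u.1) !(addrC u.2) !addrK -surjective_pairing. Qed.

Lemma origin_shift_inj u : injective (origin_shift u).
Proof. by move=> [x y] [x' y'] [] /addIr -> /addIr ->. Qed.

Lemma near_shift u v w : near (origin_shift u v) (origin_shift u w) = near v w.
Proof. by rewrite /near /= !opprB !addrA !subrK. Qed.

Lemma mem_wall v w : in_box w -> near w v -> ~~ in_box v -> v \in wall.
Proof.
case: v w => [x y] [x' y']; rewrite /in_box /near /= => Hw Hn Hv.
rewrite mem_filter; apply/andP; split=> //; apply/allpairsP; exists (x, y).
by rewrite !mem_zrange; split=> //=; lia.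
Qed.

(** By induction, a fire leaving the box on turn [t.+1] would enter a cell of [wall] at distance at
    most [t.+1], which is protected by turn [t] according to [wall_in_time]. *)
Lemma burning_dry (u : strong_grid) t (v : strong_grid) :
  burning u (plan_at u) t v -> ~~ dry t (origin_shift u v).
Proof.
rewrite /dry negbK; elim: t v => [|t IH] v.
  by move=> ->; rewrite /origin_shift !subrr.
have ballS w : in_ball t w -> in_ball t.+1 w by rewrite /in_ball; lia.
case=> [/IH/andP[-> /ballS]//|[_ npv [w /IH/andP[]]]].
move=> w_box w_ball /andP[_]; rewrite -/(near w v) -(near_shift u) => wv.
set z := origin_shift u v in wv *.
have z_ball : in_ball t.+1 z by move: w_ball wv; rewrite /in_ball /near; clear; lia.
rewrite z_ball andbT; apply: contrapT => /negP z_box.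
have /hasP[s] := allP wall_in_time _ (mem_wall w_box wv z_box).
rewrite mem_iota => /andP[_ s_lt] /hasP[i]; rewrite mem_iota => i4 /eqP zE.
apply: npv; exists s, (Ordinal i4); split.
  by rewrite -ltnS; apply: leq_trans s_lt _; rewrite geq_max.
by apply: (@origin_shift_inj u); rewrite shift_plan_at.
Qed.

Lemma dry_unburnt (u : strong_grid) t (v : strong_grid) :
  dry t (origin_shift u v) -> (~` burning u (plan_at u) t)%classic v.
Proof. by move=> dv /burning_dry; rewrite dv. Qed.

Lemma dist_le_in2 (A : set strong_grid) (x m y : strong_grid) :
  A x -> A m -> A y -> near x m -> near m y -> dist_le_in A 2 x y.
Proof.
move=> Ax Am Ay xm my.
case: (eqVneq x m) => [xEm|x_m]; last case: (eqVneq m y) => [mEy|m_y].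
- case: (eqVneq x y) => [<-|x_y].
    by exists [::]; split=> //=; case.
  exists [:: y]; split=> //=; first by rewrite strong_adj_near x_y xEm my.
  by case=> [|[|]].
- exists [:: m]; split=> //=; first by rewrite strong_adj_near x_m xm.
  by case=> [|[|]].
exists [:: m; y]; split=> //=; first by rewrite !strong_adj_near x_m m_y xm my.
by case=> [|[|[|]]].
Qed.

Lemma plan_dry t (i : 'I_4) : dry t.+1 (plan t i).
Proof.
have i4 : val i \in iota 0 4 by rewrite mem_iota /=.
case: (ltnP t 31) => [t31|t31].
  have t_in : t \in iota 0 31 by rewrite mem_iota.
  by have /allP/(_ _ i4)/and3P[] := allP plan_moves _ t_in.
rewrite /dry /plan (minn_idPr t31) -/(plan 31 i).
by rewrite (negbTE (allP plan_end _ i4)).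
Qed.

Lemma plan_legal (u : strong_grid) : legal 2 u (plan_at u).
Proof.
split=> [i ui|t i].
  have := @burning_dry u 0 _ ui; rewrite shift_plan_at.
  by case: i {ui} => -[|[|[|[|]]]].
have i4 : val i \in iota 0 4 by rewrite mem_iota /=.
case: (ltnP t 31) => [t31|t31]; last first.
  (* From turn 31 on everyone stays put, so the empty walk suffices. *)
  have -> : plan_at u t.+1 i = plan_at u t i.
    by rewrite /plan_at /plan (minn_idPr t31) (minn_idPr (leqW t31)).
  exists [::]; split=> //= j; rewrite leqn0 => /eqP ->.
  by apply: (@dry_unburnt u t.+1 (plan_at u t i)); rewrite shift_plan_at plan_dry.
have t_in : t \in iota 0 31 by rewrite mem_iota.
have /allP/(_ _ i4)/and3P[d1 d2 /hasP[m]] := allP plan_moves _ t_in.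
move=> /allpairsP[[x y] /= [x_in y_in ->]] /andP[dm my].
rewrite !mem_zrange in x_in y_in.
have mE : origin_shift u (u.1 + x, u.2 + y) = (x, y).
  by rewrite /origin_shift /= !(addrC u.1) !(addrC u.2) !addrK.
apply: (@dist_le_in2 _ _ (u.1 + x, u.2 + y)).
- by apply: (@dry_unburnt u t.+1 (plan_at u t i)); rewrite shift_plan_at.
- by apply: (@dry_unburnt u t.+1 (u.1 + x, u.2 + y)); rewrite mE.
- by apply: (@dry_unburnt u t.+1 (plan_at u t.+1 i)); rewrite shift_plan_at.
- by rewrite -(near_shift u) shift_plan_at mE /near /=; lia.
- by rewrite -(near_shift u) shift_plan_at mE.
Qed.

Lemma plan_contained (u : strong_grid) : contained u (plan_at u).
Proof.
apply: (@bounded_contained _ _ _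
  [seq (u.1 + x, u.2 + y) | x <- zrange (-31) 1, y <- zrange (-12) 0]).
move=> t v /burning_dry; rewrite /dry negbK => /andP[v_box _].
apply/allpairsP; exists (origin_shift u v).
move: v_box; rewrite /in_box !mem_zrange /origin_shift /= => /andP[-> ->].
by split=> //; case: v => x y /=; rewrite !(addrC u.1) !(addrC u.2) !subrK.
Qed.

Theorem lemma4p1 : fire_number strong_grid 2 4.
Proof.
move=> u; split.
  by exists (plan_at u); split; [exact: plan_legal|exact: plan_contained].
move=> k [pos [_ cont]]; rewrite leqNgt; apply/negP => k4.
exact: (three_not_contained k4 cont).
Qed.
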